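(* Let $d\ge 1$, let $I$ be a compact interval, let $S_d:I\to I$ be a sawtooth map of a given shape $s_1s_2\cdots s_{d+1}$, and let $S_w:I\to I$ be the stunted sawtooth map obtained from $S_d$ with critical value vector $w=(w_1,\dots,w_d)$. Suppose that the set of periods of $S_w$ is $P(S_w)=\{2^i : i\in\mathbb{N}\}=\{1,2,4,\dots\}$. Then for every $\epsilon>0$ there exist critical value vectors $w'$ and $w''$ (for the same shape) such that $|w'-w|<\epsilon$, $|w''-w|<\epsilon$, the topological entropy satisfies $h(S_{w'})>0$, and $S_{w''}$ has only finitely many periods (i.e. the set $P(S_{w''})$ is finite).
   Context: $\mathbb{N}$ includes $0$. A point $x$ is a periodic point of period $n\ge 1$ of a map $f$ if $f^n(x)=x$ and $f^i(x)\ne x$ for $0<i<n$; $P(f)$ denotes the set of periods of all periodic points of $f$. Sawtooth maps. Let $s_1,\dots,s_{d+1}\in\{+,-\}$ with $s_{i+1}=-s_i$. The sawtooth map of shape $s_1s_2\cdots s_{d+1}$ is the unique continuous piecewise linear map $S_d:I\to I$ with successive slopes $s_1(d+1),s_2(d+1),\dots,s_{d+1}(d+1)$; that is, $I=[c_0,c_{d+1}]$ is divided by points $c_0<c_1<\dots<c_{d+1}$ into $d+1$ intervals (''laps'') $[c_{j-1},c_j]$ of equal length, and $S_d$ maps each lap $[c_{j-1},c_j]$ affinely onto $I$ with slope $s_j(d+1)$. Critical value vectors. A critical value vector (for the given shape) is $w=(w_1,\dots,w_d)\in I^d$ satisfying $(w_j-w_{j+1})\cdot s_{j+1}<0$ for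 $j=1,\dots,d-1$ (the sign $s_{j+1}$ being read as $\pm1$). Stunted sawtooth maps. $S_w$ is obtained from $S_d$ by cutting off the tops and bottoms of the graph at the heights $w_j$: if $s_j=+$ (so $c_j$ is a local maximum of $S_d$), on the two laps adjacent to $c_j$ the values of $S_d$ larger than $w_j$ are replaced by $w_j$; if $s_j=-$ (so $c_j$ is a local minimum of $S_d$), on the two laps adjacent to $c_j$ the values of $S_d$ smaller than $w_j$ are replaced by $w_j$; this is done for all $j=1,\dots,d$. *)

(* Defs.v *)
From HB Require Import structures.
From mathcomp Require Import all_boot all_order all_algebra.
From mathcomp Require Import all_classical all_reals all_analysis.

Set Implicit Arguments.
Unset Strict Implicit.
Unset Printing Implicit Defensive.

Import Order.TTheory GRing.Theory Num.Theory.
Import numFieldNormedType.Exports.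

Local Open Scope classical_set_scope.
Local Open Scope ring_scope.

(** All maps below are functions [R -> R], of which only the restriction to the
    compact interval [`[a, b]] matters.  Indices start at 0: the sign written
    $s_i$ with $1 \le i \le d+1$ is [s j] with [j = i - 1 : 'I_d.+1], and the
    critical value $w_i$ with $1 \le i \le d$ is [w ord0 j] with
    [j = i - 1 : 'I_d]; it belongs to the critical point [lap_pt a b d j.+1]. *)

Definition periods (T : Type) (X : set T) (f : T -> T) : set nat :=
  [set n | (0 < n)%N /\ exists x, [/\ X x, iter n f x = x &
     forall i, (0 < i < n)%N -> iter i f x <> x]].

(** Bowen's definition of topological entropy; [E] is $(n,e)$-separated when any
    two distinct points of [E] are at distance at least [e] for the metric
    $\max_{i<n} |f^i x - f^i y|$. *)
Definition dyn_separated (R : realType) (f : R -> R) (n : nat) (e : R)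
    (E : set R) : Prop :=
  forall x y, E x -> E y -> x <> y ->
    exists2 i, (i < n)%N & e <= `|iter i f x - iter i f y|.

Definition max_separated (R : realType) (X : set R) (f : R -> R) (n : nat)
    (e : R) : \bar R :=
  ereal_sup [set (size E)%:R%:E | E in
    [set E : seq R | [/\ uniq E, [set` E] `<=` X & dyn_separated f n e [set` E]]]].

Definition topological_entropy (R : realType) (X : set R) (f : R -> R) : \bar R :=
  lim ((limn_esup (fun n => ((n%:R^-1)%:E * lne (max_separated X f n e))%E))
         @[e --> 0^'+]).

(** [true] stands for $+$ and [false] for $-$. *)
Definition is_shape (d : nat) (s : 'I_d.+1 -> bool) : Prop :=
  forall i j : 'I_d.+1, j = i.+1 :> nat -> s j = ~~ s i.

Definition sgnb (R : realType) (s : bool) : R := if s then 1 else -1.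

Definition lap_pt (R : realType) (a b : R) (d j : nat) : R :=
  a + j%:R * (b - a) / d.+1%:R.

Definition lap (R : realType) (a b : R) (d j : nat) : set R :=
  `[lap_pt a b d j, lap_pt a b d j.+1].

Definition sawtooth (R : realType) (a b : R) (d : nat) (s : 'I_d.+1 -> bool)
    (S : R -> R) : Prop :=
  {within `[a, b], continuous S} /\
  forall j : 'I_d.+1,
    (forall x y, lap a b d j x -> lap a b d j y ->
       S y - S x = sgnb R (s j) * d.+1%:R * (y - x)) /\
    S @` lap a b d j = `[a, b]%classic.

Definition critical_value_vector (R : realType) (a b : R) (d : nat)
    (s : 'I_d.+1 -> bool) (w : 'rV[R]_d) : Prop :=
  (forall j : 'I_d, w ord0 j \in `[a, b]) /\
  (forall j k : 'I_d, k = j.+1 :> nat ->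
     (w ord0 j - w ord0 k) * sgnb R (s (widen_ord (leqnSn d) k)) < 0).

(** Cuts the value [y] taken at the point [x] at the height [w ord0 j], provided
    that [x] lies in one of the two laps adjacent to [lap_pt a b d j.+1]. *)
Definition cut (R : realType) (a b : R) (d : nat) (s : 'I_d.+1 -> bool)
    (w : 'rV[R]_d) (x y : R) (j : 'I_d) : R :=
  if lap_pt a b d j <= x <= lap_pt a b d j.+2 then
    if s (widen_ord (leqnSn d) j) then Num.min y (w ord0 j)
    else Num.max y (w ord0 j)
  else y.

(** For a critical value vector the order of the cuts is irrelevant: on the lap
    between a local minimum and a local maximum the lower cut is below the upper
    one, and at a critical point only its own cut has an effect. *)
Definition stunted (R : realType) (a b : R) (d : nat) (s : 'I_d.+1 -> bool)
    (S : R -> R) (w : 'rV[R]_d) (x : R) : R :=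
  foldl (cut a b s w x) (S x) (enum 'I_d).

(* Main.v *)
Require Import Defs.
From mathcomp Require Import all_boot all_order all_algebra.
From mathcomp Require Import all_classical all_reals all_analysis.
From mathcomp Require Import ring lra zify.
Import Order.TTheory GRing.Theory Num.Theory.
Import numFieldNormedType.Exports.
Local Open Scope classical_set_scope.
Local Open Scope ring_scope.

(** The argument rests on the expansion of the sawtooth map $S$, whose slopes
    are $\pm(d+1)$ with $d+1 \ge 2$.

    A periodic orbit of $S_v$ either passes through one of the $d$ values $v_i$,
    or is an orbit of $S$ that no cut of $S_v$ modifies; call it uncut.  Hence a
    stunted map with infinitely many periods has uncut orbits of arbitrarily
    large period ([infinite_periods_long_orbits]).

    Suppose that this holds for $v$, and move each $v_i$ outwards: maxima up,
    minima down, by at least some $\rho > 0$ unless they reach an end of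
    $[a, b]$.  Let $g = S_{v'}$ be the new map.  If $x$ is uncut for $v$, every
    point of $[a, b]$ within $\rho$ of $S x$ has a $g$-preimage near $x$, given by
    an affine branch of slope $\pm 1/(d+1)$; along an uncut orbit these branches
    compose ([stunted_iter_branch]).  A long uncut orbit in a bounded interval
    contains two points $p \ne q$ at distance at most $\rho/2$.  If $N$ is
    its period, the branches of $g^N$ at $p$ and at $q$ contract the same
    interval around $p$ and $q$ into disjoint subintervals of itself: $g^N$ has
    a two-branch horseshoe ([long_orbits_horseshoe]).

    A horseshoe has two consequences.  The $2^m$ words of length $m$ in its
    branches give $2^m$ points that $g$ separates within $mN$ steps, so that the
    entropy is at least $\ln 2 / N$ ([horseshoe_entropy]).  The fixed point of
    the word $ppq$ is fixed by $g^{3N}$ but not by $g^N$, so that, if $N$ is a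
    power of $2$, its period is divisible by $3$ ([horseshoe_period]).

    For $w'$, move $w$ outwards by a small amount: $S_w$ has infinitely many
    periods, so $S_{w'}$ has positive entropy.  For $w''$, move $w$ inwards, so
    that $w$ is an outward move of $w''$: if $S_{w''}$ had infinitely many
    periods, $S_w$ would have a horseshoe for $g^N$ with $N$ one of its periods,
    hence a power of $2$, and then a period divisible by $3$. *)

(** * Affine horseshoes *)

(** The branches $y \mapsto c_i + t_i y$ are right inverses of [h] with values in
    $[l, r]$.  Asking that they be affine gives the fixed points of their
    compositions by solving an equation, without continuity of [h]. *)
Definition affine_horseshoe {R : realType} (h : R -> R) (l r e : R)
    (c t : bool -> R) : Prop :=
  [/\ l <= r, 0 < e, forall i, `|t i| < 1,
    forall i y, l <= y <= r ->
      l <= c i + t i * y <= r /\ h (c i + t i * y) = y &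
    forall y z, l <= y <= r -> l <= z <= r ->
      e <= `|(c true + t true * y) - (c false + t false * z)|].

(** The point of which the [h]-orbit uses the branches [u], in this order, before
    it arrives at [y]. *)
Definition code_point {R : realType} (c t : bool -> R) (y : R) (u : seq bool) : R :=
  foldr (fun i z => c i + t i * z) y u.



Lemma code_point_itv {R : realType} {h : R -> R} {l r e : R} {c t : bool -> R}
    (hh : affine_horseshoe h l r e c t) {y : R} (hy : l <= y <= r)
    (u : seq bool) :
  l <= code_point c t y u <= r.
Proof.
by case: hh => _ _ _ br _; elim: u => //= i u IH; have [] := br i _ IH.
Qed.

Lemma iter_code_point {R : realType} {h : R -> R} {l r e : R} {c t : bool -> R}
    (hh : affine_horseshoe h l r e c t) {y : R} (hy : l <= y <= r)
    (u : seq bool) (k : nat) (hk : (k <= size u)%N) :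
  iter k h (code_point c t y u) = code_point c t y (drop k u).
Proof.
elim: u k hk => [|i u IH] [|k] //= hk; rewrite -IH // -iterS iterSr.
congr iter; case: (hh) => _ _ _ br _.
by have [_] := br i _ (code_point_itv hh hy u).
Qed.

(** At the first place where the words differ, the two orbits are in the images
    of different branches. *)
Lemma code_point_separated {R : realType} {h : R -> R} {l r e : R}
    {c t : bool -> R} (hh : affine_horseshoe h l r e c t) {y : R}
    (hy : l <= y <= r) (u v : seq bool) (huv : size u = size v)
    (neq : u <> v) :
  exists2 k, (k < size u)%N &
    e <= `|iter k h (code_point c t y u) - iter k h (code_point c t y v)|.
Proof.
have [k ku nk] : exists2 k, (k < size u)%N & nth true u k <> nth true v k.
  apply/not_exists2P => H; apply: neq.
  apply: (@eq_from_nth _ true) => // i iu.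
  by have [/(_ iu)|/contrapT] := H i.
exists k => //; have kv : (k < size v)%N by rewrite -huv.
rewrite !(iter_code_point hh hy) 1?ltnW //.
rewrite (drop_nth true ku) (drop_nth true kv) /=.
have Du := code_point_itv hh hy (drop k.+1 u).
have Dv := code_point_itv hh hy (drop k.+1 v).
case: hh => _ _ _ _ sep.
case: (nth true u k) (nth true v k) nk => [] [] // _; first exact: sep.
by rewrite distrC; exact: sep.
Qed.

(** The $2^m$ words of length $m$ give as many points, and a difference at place
    $k < m$ shows at time $kN < mN$ of the orbit of [g]. *)
Lemma max_separated_horseshoe {R : realType} {X : set R} {g : R -> R} {N : nat}
    {l r e : R} {c t : bool -> R} (hN : (0 < N)%N)
    (hh : affine_horseshoe (iter N g) l r e c t) (hX : `[l, r] `<=` X)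
    (m : nat) :
  (((2 ^ m)%:R)%:E <= max_separated X g (m * N) e)%E.
Proof.
have [lr e0 _ _ _] := hh.
have hl : l <= l <= r by rewrite lexx.
pose f (u : m.-tuple bool) := code_point c t l u.
have sep (u v : m.-tuple bool) : u <> v -> exists2 k, (k < m)%N &
    e <= `|iter k (iter N g) (f u) - iter k (iter N g) (f v)|.
  move=> uv; have [||k ku] := code_point_separated hh hl u v.
  - by rewrite !size_tuple.
  - by move=> E; apply: uv; exact: val_inj.
  - by rewrite size_tuple in ku; exists k.
have finj : injective f.
  move=> u v fuv; apply: contrapT => /sep[k _].
  by rewrite fuv subrr normr0 leNgt e0.
apply: ereal_sup_ubound; exists [seq f u | u <- enum {: m.-tuple bool}]; last first.
  by rewrite size_map -cardE card_tuple card_bool.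
split.
- by rewrite map_inj_uniq // enum_uniq.
- move=> _ /= /mapP[u _ ->]; apply: hX => /=.
  by rewrite in_itv /=; exact: (code_point_itv hh hl u).
- move=> _ _ /= /mapP[u _ ->] /mapP[v _ ->] fuv.
  have [|k km] := sep u v; first by move=> E; apply: fuv; rewrite E.
  by rewrite -!iterM => ?; exists (k * N)%N => //; rewrite ltn_pmul2r.
Qed.

Lemma max_separated_nincr {R : realType} {X : set R} (g : R -> R) (n : nat) :
  {homo max_separated X g n : e e' / e <= e' >-> (e' <= e)%E}.
Proof.
move=> e e' ee'; apply: ereal_sup_le => _ [E [uE EX sE] <-].
exists E => //; split=> // x y Ex Ey xy; have [i ? ?] := sE x y Ex Ey xy.
by exists i => //; exact: le_trans ee' _.
Qed.

Lemma max_separated_ge0 {R : realType} {X : set R} (g : R -> R) (n : nat) (e : R) :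
  (0 <= max_separated X g n e)%E.
Proof. by apply: ereal_sup_ubound; exists [::] => //; split. Qed.

Lemma lne_nondecreasing {R : realType} (x y : \bar R) (x0 : (0 <= x)%E)
    (xy : (x <= y)%E) :
  (lne x <= lne y)%E.
Proof.
rewrite lee_lne // in_itv /= leey andbT //; exact: le_trans xy.
Qed.

(** The entropy is a limit of a quantity that increases as the scale decreases
    to $0$, so it is bounded below by the value at scale [e]; there the times
    $mN$ give the rate $\ln 2^m / (mN) = \ln 2 / N$. *)
Lemma horseshoe_entropy {R : realType} {X : set R} {g : R -> R} {N : nat}
    {l r e : R} {c t : bool -> R} (hN : (0 < N)%N)
    (hh : affine_horseshoe (iter N g) l r e c t) (hX : `[l, r] `<=` X) :
  (0 < topological_entropy X g)%E.
Proof.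
have e0 : 0 < e by case: hh.
rewrite /topological_entropy.
set f := (F in (F @ _)%classic).
have fni : {in `]0, +oo[ &, nonincreasing_fun f}.
  move=> x y _ _ xy; rewrite /f; apply: le_ereal_inf_tmp => _ [V Voo <-].
  apply: le_trans (ereal_inf_lbound _) _; first by exists V.
  apply: ge_ereal_sup => _ [n Vn <-].
  apply: le_trans (ereal_sup_ubound _); last by exists n.
  apply: lee_wpmul2l; first by rewrite lee_fin invr_ge0.
  by apply: lne_nondecreasing; [exact: max_separated_ge0|exact: max_separated_nincr].
have : f x @[x --> 0^'+] --> ereal_sup (f @` `]0, +oo[).
  by exact: (@nonincreasing_at_right_cvge _ f 0 (BInfty R false) isT fni).
move/cvg_lim => -> //.
apply: (@lt_le_trans _ _ (ln 2 / N%:R)%:E).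
  by rewrite lte_fin divr_gt0 ?ln_gt0 ?ltr1n ?ltr0n.
apply: le_trans (ereal_sup_ubound _); last first.
  by exists e => //=; rewrite in_itv /= e0.
apply: le_ereal_inf_tmp => _ [V [n0 _ n0V] <-].
pose m := n0.+1.
apply: le_trans (ereal_sup_ubound _); last first.
  exists (m * N)%N => //; apply: n0V => /=.
  by rewrite /m; nia.
have := lne_nondecreasing _ _ _ (max_separated_horseshoe hN hh hX m).
rewrite lne_EFin ?ltr0n ?expn_gt0 // natrX lnXn ?ltr0n // => H.
apply: le_trans (lee_wpmul2l _ (H _));
  rewrite ?lee_fin ?invr_ge0 ?ler0n ?exprn_ge0 //.
rewrite natrM invfM -[ln 2 *+ m]mulr_natr.
have m0 : (m%:R : R) != 0 by rewrite pnatr_eq0.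
have N0 : (N%:R : R) != 0 by rewrite pnatr_eq0 -lt0n.
by rewrite [leRHS]mulrC mulrA mulfK.
Qed.

(** The point is the fixed point of an affine contraction of $[l, r]$, the
    composition of the branches [true], [true], [false].  Its first two images
    under [h] are in the images of different branches, so it cannot be fixed
    by [h]. *)
Lemma horseshoe_orbit3 {R : realType} {h : R -> R} {l r e : R} {c t : bool -> R}
    (hh : affine_horseshoe h l r e c t) :
  exists z, [/\ l <= z <= r, iter 3 h z = z & h z <> z].
Proof.
have [lr e0 t1 br sep] := hh.
pose u := [:: true; true; false].
pose tau := t true * t true * t false.
have cpE y : code_point c t y u = code_point c t 0 u + tau * y.
  by rewrite /tau /=; ring.
have tau1 : tau < 1.
  apply: le_lt_trans (ler_norm _) _; rewrite /tau !normrM.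
  have := t1 true; have := t1 false.
  have := normr_ge0 (t true); have := normr_ge0 (t false).
  by nra.
pose z := code_point c t 0 u / (1 - tau).
have tn0 : 1 - tau != 0 by rewrite subr_eq0 eq_sym lt_eqF.
have hz : l <= z <= r.
  have hl : l <= l <= r by rewrite lexx.
  have hr : l <= r <= r by rewrite lexx andbT.
  have /andP[+ _] := code_point_itv hh hl u.
  have /andP[_ +] := code_point_itv hh hr u.
  rewrite !(cpE l) !(cpE r) /z ler_pdivlMr ?subr_gt0 // ler_pdivrMr ?subr_gt0 //.
  by move=> ? ?; apply/andP; split; lra.
have zE : code_point c t z u = z.
  by rewrite cpE /z; field.
exists z; split=> //.
  by rewrite -{1}zE (iter_code_point hh hz).
move=> hzz.
have h1 := iter_code_point hh hz u 1 isT.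
have h2 := iter_code_point hh hz u 2 isT.
rewrite zE /= hzz /= in h1; rewrite zE /= !hzz in h2.
have /le_lt_trans := sep (c false + t false * z) z (br false z hz).1 hz.
by rewrite -h1 -h2 subrr normr0 => /(_ _ e0); rewrite ltxx.
Qed.

(** The period of the point of [horseshoe_orbit3] divides $3 \cdot 2^m$ and not
    $2^m$. *)
Lemma horseshoe_period {R : realType} {X : set R} {g : R -> R} {m : nat}
    {l r e : R} {c t : bool -> R}
    (hh : affine_horseshoe (iter (2 ^ m) g) l r e c t) (hX : `[l, r] `<=` X) :
  exists2 n, periods X g n & forall i, n <> (2 ^ i)%N.
Proof.
have [z [hz z3 z1]] := horseshoe_orbit3 hh.
have ex : exists n, (0 < n)%N && (iter n g z == z).
  exists (3 * 2 ^ m)%N; rewrite muln_gt0 expn_gt0 /=.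
  by rewrite iterM z3.
have := ex_minnP ex; case: ex_minnP => n /andP[n0 /eqP nz] nmin _.
have iterz k : iter (k * n) g z = z.
  by elim: k => // k IH; rewrite mulSn iterD IH.
exists n.
  split=> //; exists z; split=> //; first by apply: hX; rewrite /= in_itv.
  move=> i /andP[i0 ni] /eqP iz.
  by have := nmin i; rewrite i0 iz => /(_ isT); rewrite leqNgt ni.
have n3 : (n %| 3 * 2 ^ m)%N.
  rewrite /dvdn; apply: contraT; rewrite -lt0n => k0.
  have := nmin ((3 * 2 ^ m) %% n)%N; rewrite k0 /=.
  rewrite leqNgt ltn_mod n0 => H; apply: H; apply/eqP.
  rewrite -[in LHS](iterz ((3 * 2 ^ m) %/ n)%N) -iterD addnC -divn_eq.
  by rewrite iterM z3.
move=> i nE; apply: z1.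
have : (n %| 2 ^ m)%N.
  by rewrite -(@Gauss_dvdr _ 3) // nE coprimeXl.
by move=> /dvdnP[k ->]; exact: iterz.
Qed.


(** * Laps and sawtooth maps *)

Lemma ler_lap_pt {R : realType} {a b : R} {d : nat} (hab : a < b) (i j : nat) :
  (lap_pt a b d i <= lap_pt a b d j) = (i <= j)%N.
Proof.
rewrite /lap_pt lerD2l !ler_pM2r ?ler_nat ?subr_gt0 ?invr_gt0 ?ltr0n //.
Qed.

Lemma lap_pt0 {R : realType} {a b : R} {d : nat} : lap_pt a b d 0 = a.
Proof. by rewrite /lap_pt !mul0r addr0. Qed.

Lemma lap_ptS {R : realType} {a b : R} {d : nat} : lap_pt a b d d.+1 = b.
Proof.
have d0 : d.+1%:R != 0 :> R by rewrite pnatr_eq0.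
by rewrite /lap_pt mulrAC mulfV // mul1r addrC subrK.
Qed.

Lemma lap_sub_itv {R : realType} {a b : R} {d : nat} (hab : a < b)
    (j : 'I_d.+1) : lap a b d j `<=` `[a, b].
Proof.
move=> x; rewrite /lap /= !in_itv /= => /andP[lx xr]; apply/andP; split.
  by apply: le_trans lx; rewrite -{1}(@lap_pt0 _ a b d) ler_lap_pt.
by apply: le_trans xr _; rewrite -{2}(@lap_ptS _ a b d) ler_lap_pt.
Qed.

Lemma lap_cover {R : realType} {a b : R} {d : nat} {x : R}
    (hx : a <= x <= b) : exists j : 'I_d.+1, lap a b d j x.
Proof.
have ex : exists n, x <= lap_pt a b d n.+1.
  by exists d; rewrite lap_ptS; case/andP: hx.
case: (ex_minnP ex) => n xn nmin.
have nd : (n < d.+1)%N.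
  by rewrite ltnS nmin // lap_ptS; case/andP: hx.
exists (Ordinal nd); rewrite /lap /= in_itv /= xn andbT.
case: n {nd} xn nmin => [|n] _ nmin; first by rewrite lap_pt0; case/andP: hx.
by rewrite leNgt; apply/negP => /ltW /nmin; rewrite ltnn.
Qed.

Lemma sawtooth_itv {R : realType} {a b : R} {d : nat} {s : 'I_d.+1 -> bool}
    {S : R -> R} (hS : sawtooth a b s S) {x : R} (hx : a <= x <= b) :
  a <= S x <= b.
Proof.
have [j jx] := lap_cover (d := d) hx.
have [_ /(_ j)[_ img]] := hS.
have : `[a, b]%classic (S x) by rewrite -img; exists x.
by rewrite /= in_itv.
Qed.

(** On a lap the graph of a sawtooth map is a diagonal of a rectangle, so its
    direction alone determines the values at both ends. *)
Lemma sawtooth_lap_ends {R : realType} {a b : R} {d : nat}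
    {s : 'I_d.+1 -> bool} {S : R -> R} (hab : a < b) (hS : sawtooth a b s S)
    (j : 'I_d.+1) :
  S (lap_pt a b d j) = (if s j then a else b) /\
  S (lap_pt a b d j.+1) = (if s j then b else a).
Proof.
have [_ /(_ j)[aff img]] := hS.
have lr : lap_pt a b d j <= lap_pt a b d j.+1 by rewrite ler_lap_pt.
have Lj : lap a b d j (lap_pt a b d j) by rewrite /lap /= in_itv /= lexx.
have Rj : lap a b d j (lap_pt a b d j.+1) by rewrite /lap /= in_itv /= lexx andbT.
have := sawtooth_itv hS (lap_sub_itv hab j _ Lj).
have := sawtooth_itv hS (lap_sub_itv hab j _ Rj).
have [x jx Sx] : (S @` lap a b d j) a by rewrite img /= in_itv /= lexx ltW.
have [y jy Sy] : (S @` lap a b d j) b by rewrite img /= in_itv /= lexx ltW.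
have := (aff _ _ Lj jx, aff _ _ Lj jy, aff _ _ jx Rj, aff _ _ jy Rj).
rewrite Sx Sy.
move: jx jy; rewrite /lap /= !in_itv /= => /andP[x1 x2] /andP[y1 y2].
have d0 : 0 < d.+1%:R :> R by rewrite ltr0n.
have P1 : 0 <= d.+1%:R * (x - lap_pt a b d j) by rewrite mulr_ge0 ?subr_ge0 // ltW.
have P2 : 0 <= d.+1%:R * (y - lap_pt a b d j) by rewrite mulr_ge0 ?subr_ge0 // ltW.
have P3 : 0 <= d.+1%:R * (lap_pt a b d j.+1 - x)
  by rewrite mulr_ge0 ?subr_ge0 // ltW.
have P4 : 0 <= d.+1%:R * (lap_pt a b d j.+1 - y)
  by rewrite mulr_ge0 ?subr_ge0 // ltW.
rewrite /sgnb; case: (s j) => -[[[]]]; rewrite ?mul1r ?mulN1r ?mulNr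
  => ? ? ? ? /andP[? ?] /andP[? ?].
  by split; apply/eqP; rewrite eq_le; apply/andP; split; lra.
by split; apply/eqP; rewrite eq_le; apply/andP; split; lra.
Qed.

(** * Stunted maps and inverse branches *)

Definition uncut {R : realType} (a b : R) {d : nat} (s : 'I_d.+1 -> bool)
    (S : R -> R) (v : 'rV[R]_d) (x : R) : Prop :=
  forall i : 'I_d, Defs.cut a b s v x (S x) i = S x.

Lemma stunted_uncut {R : realType} {a b : R} {d : nat} {s : 'I_d.+1 -> bool}
    {S : R -> R} {v : 'rV[R]_d} {x : R} (hx : uncut a b s S v x) :
  stunted a b s S v x = S x.
Proof. by rewrite /stunted; elim: (enum _) => //= i u IH; rewrite hx. Qed.

(** Each cut either keeps a value or replaces it by some $v_i$, so a value that
    has changed at all ends up among the $v_i$, whatever the order of the cuts. *)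
Lemma stunted_cases {R : realType} (a b : R) {d : nat} (s : 'I_d.+1 -> bool)
    (S : R -> R) (v : 'rV[R]_d) (x : R) :
  uncut a b s S v x \/ exists i, stunted a b s S v x = v ord0 i.
Proof.
have cutE y i : Defs.cut a b s v x y i = y \/ Defs.cut a b s v x y i = v ord0 i.
  rewrite /Defs.cut; case: ifP => _; last by left.
  by case: ifP => _; [rewrite minEle|rewrite maxEle]; case: ifP => _; auto.
suff H (u : seq 'I_d) y : (forall i, i \in u -> Defs.cut a b s v x y i = y) \/
    exists i, foldl (Defs.cut a b s v x) y u = v ord0 i.
  have [H1|] := H (enum 'I_d) (S x); last by right.
  by left=> i; apply: H1; rewrite mem_enum.
suff H : ((forall i, i \in u -> Defs.cut a b s v x y i = y) /\
    foldl (Defs.cut a b s v x) y u = y) \/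
    exists i, foldl (Defs.cut a b s v x) y u = v ord0 i.
  by case: H => [[]|]; auto.
elim: u y => [|i u IH] y; first by left.
have [yi|yi] /= := cutE y i; rewrite yi.
  have [[H1 H2]|] := IH y; last by right.
  by left; split=> // k; rewrite inE => /predU1P[->|/H1].
by right; have [[_ ->]|//] := IH (v ord0 i); exists i.
Qed.

(** The values that are already extreme need not move: there the cut has no
    effect, and inverse branches exist up to the end of the interval. *)
Definition outward {R : realType} (a b : R) {d : nat} (s : 'I_d.+1 -> bool)
    (v v' : 'rV[R]_d) : Prop :=
  forall i : 'I_d, if s (widen_ord (leqnSn d) i)
    then v' ord0 i = b \/ v ord0 i < v' ord0 i
    else v' ord0 i = a \/ v' ord0 i < v ord0 i.

Definition outward_by {R : realType} (a b : R) {d : nat} (s : 'I_d.+1 -> bool)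
    (rho : R) (v v' : 'rV[R]_d) : Prop :=
  forall i : 'I_d, if s (widen_ord (leqnSn d) i)
    then v' ord0 i = b \/ v ord0 i + rho <= v' ord0 i
    else v' ord0 i = a \/ v' ord0 i + rho <= v ord0 i.

Lemma finite_gt0_lower_bound {R : realType} {T : finType} (F : T -> R)
    (hF : forall i, 0 < F i) : exists2 rho, 0 < rho & forall i, rho <= F i.
Proof.
exists (\big[Num.min/1]_i F i); last by move=> i; exact: bigmin_le_cond.
by apply: lt_bigmin.
Qed.

Lemma outward_margin {R : realType} {a b : R} {d : nat} {s : 'I_d.+1 -> bool}
    {v v' : 'rV[R]_d} (h : outward a b s v v') :
  exists2 rho, 0 < rho & outward_by a b s rho v v'.
Proof.
pose F i := if v' ord0 i == v ord0 i then 1 else `|v' ord0 i - v ord0 i|.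
have [i|rho rho0 rhoF] := finite_gt0_lower_bound F.
  by rewrite /F; case: eqP => // /eqP; rewrite normr_gt0 subr_eq0.
exists rho => // i; have := h i; have := rhoF i; rewrite /F.
case: (s _) => + [->|lt]; auto.
  by rewrite gt_eqF // gtr0_norm ?subr_gt0 // => ?; right; lra.
by rewrite lt_eqF // ltr0_norm ?subr_lt0 // => ?; right; lra.
Qed.

(** The lap that contains [x] is mapped affinely onto $[a, b]$, so the branch of
    [S] at [x] is defined on all of $[a, b]$.  The values within [rho] of [S x]
    are not cut at the heights [v'], because [S x] is not cut at the heights
    [v]. *)
Lemma stunted_branch {R : realType} {a b : R} {d : nat} {s : 'I_d.+1 -> bool}
    {S : R -> R} {v v' : 'rV[R]_d} {rho : R} (hab : a < b) (hs : is_shape s)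
    (hS : sawtooth a b s S) (hv' : forall i, a <= v' ord0 i <= b)
    (hout : outward_by a b s rho v v')
    {x : R} (hx : a <= x <= b) (ux : uncut a b s S v x) :
  exists2 t, `|t| = d.+1%:R^-1 & forall y, a <= y <= b -> `|y - S x| <= rho ->
    a <= x + t * (y - S x) <= b /\
    stunted a b s S v' (x + t * (y - S x)) = y.
Proof.
have d0 : d.+1%:R != 0 :> R by rewrite pnatr_eq0.
have [j jx] := lap_cover (d := d) hx.
have [_ /(_ j)[aff img]] := hS.
exists (sgnb R (s j) / d.+1%:R).
  rewrite normrM /sgnb normfV normr_nat.
  by case: (s j); rewrite ?normrN normr1 mul1r.
move=> y hy hyx.
have [z jz Sz] : (S @` lap a b d j) y by rewrite img /= in_itv.
have zE : x + sgnb R (s j) / d.+1%:R * (y - S x) = z.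
  rewrite -Sz (aff x z jx jz) /sgnb.
  by move: (d.+1%:R : R) d0 => D D0; case: (s j); field.
rewrite zE; have hz := lap_sub_itv hab j _ jz.
split; first by move: hz; rewrite /= in_itv.
rewrite -[RHS]Sz; apply: stunted_uncut => i; rewrite Sz /Defs.cut.
case: ifP => // /andP[iz zi].
set i1 := widen_ord (leqnSn d) i.
have id : (i.+1 < d.+1)%N by rewrite ltnS.
have sS : s (Ordinal id) = ~~ s i1 by exact: hs.
have [El _] := sawtooth_lap_ends hab hS i1.
have [_ Er] := sawtooth_lap_ends hab hS (Ordinal id).
rewrite /= sS in El Er.
(* Either [x] lies in the two laps cut at height [v' ord0 i], or [z] is an
   outer end of them, where the sawtooth takes the opposite extreme value. *)
have [ix|] := boolP (lap_pt a b d i <= x <= lap_pt a b d i.+2); last first.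
  move=> nx; have yE : y = if s i1 then a else b.
    move: nx; rewrite negb_and -!ltNge.
    move: jx jz; rewrite /lap /= !in_itv /= => /andP[jx xj] /andP[jz zj].
    case/orP=> [xi|ix].
      have ji : (j < i)%N.
        by rewrite ltnNge -(ler_lap_pt hab (d:=d)) -ltNge (le_lt_trans jx).
      have ij : (i <= j.+1)%N by rewrite -(ler_lap_pt hab (d:=d)) (le_trans iz).
      have iE : j.+1 = i by apply/eqP; rewrite eqn_leq ji ij.
      by rewrite -Sz -El; congr S; apply/eqP; rewrite eq_le iz -iE zj.
    have ji : (i.+2 < j.+1)%N.
      by rewrite ltnNge -(ler_lap_pt hab (d:=d)) -ltNge (lt_le_trans ix).
    have ij : (j <= i.+2)%N by rewrite -(ler_lap_pt hab (d:=d)) (le_trans jz).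
    have iE : j = i.+2 :> nat by apply/eqP; rewrite eqn_leq ij.
    rewrite -Sz; case: (s i1) Er => /= <-; congr S; apply/eqP;
      by rewrite eq_le zi -iE jz.
  have /andP[va vb] := hv' i; rewrite yE.
  by case: (s i1); [rewrite min_l|rewrite max_l].
have := ux i; rewrite /Defs.cut ix.
have := hout i; rewrite -/i1; have /andP[ya yb] := hy.
move: hyx; rewrite ler_distl => /andP[y1 y2].
case: (s i1) => -[->|m].
- by move=> _; rewrite min_l.
- by move/min_idPl=> H; rewrite min_l //; lra.
- by move=> _; rewrite max_l.
- by move/max_idPl=> H; rewrite max_l //; lra.
Qed.

Definition uncut_orbit {R : realType} (a b : R) {d : nat} (s : 'I_d.+1 -> bool)
    (S : R -> R) (v : 'rV[R]_d) (x : R) : Prop :=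
  forall k, a <= iter k S x <= b /\ uncut a b s S v (iter k S x).

Lemma iter_uncut {R : realType} {a b : R} {d : nat} {s : 'I_d.+1 -> bool}
    {S : R -> R} {v : 'rV[R]_d} {x : R} (hx : uncut_orbit a b s S v x) (k : nat) :
  iter k (stunted a b s S v) x = iter k S x.
Proof. by elim: k => //= k ->; rewrite stunted_uncut //; case: (hx k). Qed.

(** Branches along an orbit compose because each of them is a contraction, so that
    the points stay within [rho] of the orbit. *)
Lemma stunted_iter_branch {R : realType} {a b : R} {d : nat}
    {s : 'I_d.+1 -> bool} {S : R -> R} {v v' : 'rV[R]_d} {rho : R}
    (hab : a < b) (hs : is_shape s)
    (hS : sawtooth a b s S) (hv' : forall i, a <= v' ord0 i <= b)
    (hout : outward_by a b s rho v v')
    {x : R} (hx : uncut_orbit a b s S v x) (N : nat) :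
  exists2 t, `|t| = d.+1%:R^-1 ^+ N & forall y, a <= y <= b ->
    `|y - iter N S x| <= rho ->
    a <= x + t * (y - iter N S x) <= b /\
    iter N (stunted a b s S v') (x + t * (y - iter N S x)) = y.
Proof.
elim: N x hx => [|N IH] x hx.
  by exists 1; rewrite ?normr1 // => y hy _ /=; rewrite mul1r addrC subrK.
have [|t tE tP] := IH (S x).
  by move=> k; rewrite -iterSr; exact: hx.
have [xI ux] := hx 0%N.
have [t' t'E t'P] := stunted_branch hab hs hS hv' hout xI ux.
exists (t' * t); first by rewrite normrM tE t'E exprS.
move=> y hy; rewrite iterSr => hyx.
have [zI zE] := tP y hy hyx.
have [|z'I z'E] := t'P (S x + t * (y - iter N S (S x))) zI.
  rewrite addrC addKr normrM tE; apply: le_trans hyx.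
  rewrite ler_piMl // exprn_ile1 ?invr_ge0 // invf_le1 ?ler1n // ltr0n //.
have E : S x + t * (y - iter N S (S x)) - S x = t * (y - iter N S (S x)).
  by rewrite addrC addKr.
rewrite E mulrA in z'I z'E; split=> //.
by rewrite iterSr z'E.
Qed.

(** * A horseshoe near a long uncut orbit *)

(** All points of the interval are within $2(q - p)$ of both [p] and [q].  With
    slopes at most $1/8$, the branches send them within $(q - p)/4$ of [p] and
    of [q], and these two neighbourhoods are $(q - p)/2$ apart. *)
Lemma two_branch_horseshoe {R : realType} {h : R -> R} {a b p q rho tp tq : R}
    (hap : a <= p) (hpq : p < q) (hqb : q <= b) (hrho : 2 * (q - p) <= rho)
    (htp : `|tp| <= 8^-1) (htq : `|tq| <= 8^-1)
    (hp : forall y, a <= y <= b -> `|y - p| <= rho ->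
      a <= p + tp * (y - p) <= b /\ h (p + tp * (y - p)) = y)
    (hq : forall y, a <= y <= b -> `|y - q| <= rho ->
      a <= q + tq * (y - q) <= b /\ h (q + tq * (y - q)) = y) :
  affine_horseshoe h (Num.max a (p - (q - p))) (Num.min b (q + (q - p)))
    ((q - p) / 2) (fun i => if i then p - tp * p else q - tq * q)
    (fun i => if i then tp else tq).
Proof.
have pE y : p - tp * p + tp * y = p + tp * (y - p) by ring.
have qE y : q - tq * q + tq * y = q + tq * (y - q) by ring.
have memE y : (Num.max a (p - (q - p)) <= y <= Num.min b (q + (q - p))) =
    [&& a <= y <= b, p - (q - p) <= y & y <= q + (q - p)].
  by rewrite ge_max le_min; do !case: (_ <= _).
have small (t u : R) : `|t| <= 8^-1 -> `|u| <= 2 * (q - p) ->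
    `|t * u| <= (q - p) / 4.
  move=> ht hu; rewrite normrM; have := normr_ge0 t; have := normr_ge0 u; nra.
have near_p y : Num.max a (p - (q - p)) <= y <= Num.min b (q + (q - p)) ->
    [/\ a <= y <= b, `|y - p| <= 2 * (q - p) & `|y - q| <= 2 * (q - p)].
  rewrite memE => /and3P[yI y1 y2]; split=> //.
    by rewrite ler_norml; apply/andP; split; lra.
  by rewrite ler_norml; apply/andP; split; lra.
split.
- by rewrite ge_max !le_min; apply/andP; split; apply/andP; split; lra.
- lra.
- by case; apply: (@le_lt_trans _ _ 8^-1) => //; lra.
- case=> y /near_p [yI yp yq]; rewrite ?pE ?qE memE.
  + have [zI zE] := hp y yI (le_trans yp hrho); split=> //.
    rewrite zI; have := small _ _ htp yp; rewrite ler_norml => /andP[? ?].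
    by apply/andP; split; lra.
  + have [zI zE] := hq y yI (le_trans yq hrho); split=> //.
    rewrite zI; have := small _ _ htq yq; rewrite ler_norml => /andP[? ?].
    by apply/andP; split; lra.
- move=> y z /near_p [_ yp _] /near_p [_ _ zq]; rewrite pE qE distrC.
  have := small _ _ htp yp; have := small _ _ htq zq.
  rewrite !ler_norml => /andP[? ?] /andP[? ?].
  by apply: le_trans (ler_norm _); lra.
Qed.

(** Pigeonhole on the cells of length [delta]; the bound [M] does not depend on
    the sequence. *)
Lemma close_pair {R : realType} {a b delta : R} (hab : a <= b)
    (hdelta : 0 < delta) :
  exists M : nat, forall (x : nat -> R) (N : nat), (M < N)%N ->
    (forall k, a <= x k <= b) ->
    exists i j, [/\ (i < j)%N, (j < N)%N & `|x i - x j| <= delta].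
Proof.
pose bin (y : R) := Num.trunc ((y - a) / delta).
exists (bin b).+1 => x N MN xI.
have bin_le k : (bin (x k) < (bin b).+1)%N.
  rewrite ltnS; apply: le_truncn; have /andP[_ xb] := xI k.
  by rewrite ler_pM2r ?invr_gt0 // lerD2r.
pose f (k : 'I_N) : 'I_(bin b).+1 := Ordinal (bin_le k).
have : ~ injective f.
  by move/leq_card; rewrite !card_ord leqNgt MN.
move=> /injectiveP /injectivePn [i [j ij fij]].
have close (k l : 'I_N) : f k = f l -> `|x k - x l| <= delta.
  move=> /(congr1 val) /= E.
  have ge0 (y : R) : a <= y -> 0 <= (y - a) / delta.
    by move=> ay; rewrite divr_ge0 ?subr_ge0 // ltW.
  have /andP[ak _] := xI k; have /andP[al _] := xI l.
  have /andP[k1 k2] := truncn_itv (ge0 _ ak).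
  have /andP[l1 l2] := truncn_itv (ge0 _ al).
  rewrite -/(bin _) E in k1 k2; rewrite -/(bin _) in l1 l2.
  move: k1 k2 l1 l2; rewrite -natr1.
  rewrite !ler_pdivlMr // !ltr_pdivrMr // mulrDl mul1r => k1 k2 l1 l2.
  by rewrite ler_norml; apply/andP; split; lra.
have [lt|gt|E] := ltngtP i j.
- by exists i, j; split=> //; exact: close.
- by exists j, i; split=> //; apply: close.
- by move: ij; rewrite (val_inj E) eqxx.
Qed.

(** The two close points belong to the same orbit, so their branches have the
    same length [N] and are branches of one iterate.  A period larger than $3$
    makes the slopes $(d+1)^{-N}$ at most $1/8$. *)
Lemma long_orbits_horseshoe {R : realType} {a b : R} {d : nat}
    {s : 'I_d.+1 -> bool} {S : R -> R} {v v' : 'rV[R]_d} (hd : (1 <= d)%N)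
    (hab : a < b) (hs : is_shape s) (hS : sawtooth a b s S)
    (hv' : forall i, a <= v' ord0 i <= b) (hout : outward a b s v v')
    (hlong : forall M : nat, exists N x, [/\ (M < N)%N,
       uncut_orbit a b s S v x, iter N S x = x &
       forall i, (0 < i < N)%N -> iter i S x <> x]) :
  exists N, [/\ (0 < N)%N, periods `[a, b] (stunted a b s S v') N &
     exists l r e c t, `[l, r] `<=` `[a, b] /\
       affine_horseshoe (iter N (stunted a b s S v')) l r e c t].
Proof.
have [rho rho0 marg] := outward_margin hout.
have rho2 : 0 < rho / 2 by rewrite divr_gt0.
have [M closeM] := close_pair (ltW hab) rho2.
have [N [x [MN ux xN xmin]]] := hlong (maxn M 3).
have [MN' N3] : (M < N)%N /\ (3 < N)%N.
  by move: MN; rewrite gtn_max => /andP[].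
have N0 : (0 < N)%N by apply: leq_trans N3.
have iterE k : iter k (stunted a b s S v') x = iter k S x.
  have [u _ uP] := stunted_iter_branch hab hs hS hv' marg ux k.
  have [|_] := uP _ (ux k).1; first by rewrite subrr normr0 ltW.
  by rewrite subrr mulr0 addr0.
exists N; split=> //.
  split=> //; exists x; rewrite iterE; split=> //.
    by rewrite /= in_itv; exact: (ux 0%N).1.
  by move=> i; rewrite iterE; exact: xmin.
have [i [j [ij jN dij]]] := closeM (fun k => iter k S x) N MN' (fun k => (ux k).1).
have orbP k : iter N S (iter k S x) = iter k S x.
  by rewrite -iterD addnC iterD xN.
have orbU k : uncut_orbit a b s S v (iter k S x).
  by move=> m; rewrite -iterD; exact: ux.
have neq : iter i S x <> iter j S x.
  move=> E; apply: (xmin (N - j + i)%N).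
    by apply/andP; split; [rewrite addn_gt0 subn_gt0 jN|lia].
  by rewrite iterD E -iterD subnK // ltnW.
have small : d.+1%:R^-1 ^+ N <= 8^-1 :> R.
  have -> : (8 : R)^-1 = 2^-1 ^+ 3 by rewrite exprVn -natrX.
  apply: (@le_trans _ _ (2^-1 ^+ N)).
    by apply: lerXn2r; rewrite ?nnegrE ?invr_ge0 // lef_pV2 ?posrE ?ltr0n // ler_nat.
  apply: ler_wiXn2l; [by rewrite invr_ge0|by rewrite invf_le1 ?ler1n|exact: ltnW].
have horse p q : p < q -> q - p <= rho / 2 ->
    uncut_orbit a b s S v p -> uncut_orbit a b s S v q ->
    iter N S p = p -> iter N S q = q ->
    exists l r e c t, `[l, r] `<=` `[a, b] /\
       affine_horseshoe (iter N (stunted a b s S v')) l r e c t.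
  move=> pq dpq up uq pN qN.
  have [tp tpE hp] := stunted_iter_branch hab hs hS hv' marg up N.
  have [tq tqE hq] := stunted_iter_branch hab hs hS hv' marg uq N.
  rewrite pN in hp; rewrite qN in hq.
  have /= /andP[ap _] := (up 0%N).1; have /= /andP[_ qb] := (uq 0%N).1.
  exists (Num.max a (p - (q - p))), (Num.min b (q + (q - p))).
  do 3 eexists; split; last first.
    apply: (two_branch_horseshoe ap pq qb _ _ _ hp hq); rewrite ?tpE ?tqE //.
    by lra.
  by move=> y; rewrite /= !in_itv /= ge_max le_min => /andP[/andP[-> _] /andP[-> _]].
have [lt|gt|//] := ltgtP (iter i S x) (iter j S x).
  apply: (horse _ _ lt _ (orbU _) (orbU _) (orbP _) (orbP _)).
  by move: dij; rewrite distrC gtr0_norm ?subr_gt0.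
apply: (horse _ _ gt _ (orbU _) (orbU _) (orbP _) (orbP _)).
by move: dij; rewrite gtr0_norm ?subr_gt0.
Qed.

(** A periodic orbit that is cut somewhere passes through some $v_i$, whose period
    is unique: such orbits contribute at most $d$ periods. *)
Lemma infinite_periods_long_orbits {R : realType} {a b : R} {d : nat}
    {s : 'I_d.+1 -> bool} {S : R -> R} {v : 'rV[R]_d} (hS : sawtooth a b s S)
    (hinf : infinite_set (periods `[a, b] (stunted a b s S v))) (M : nat) :
  exists N x, [/\ (M < N)%N, uncut_orbit a b s S v x, iter N S x = x &
     forall i, (0 < i < N)%N -> iter i S x <> x].
Proof.
apply: contrapT => nolong; apply: hinf.
set g := stunted a b s S v.
pose minper y n := [/\ (0 < n)%N, iter n g y = y &
  forall i, (0 < i < n)%N -> iter i g y <> y].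
have minper_uniq y n m : minper y n -> minper y m -> n = m.
  move=> [n0 ny nmin] [m0 my mmin]; have [nm|mn|//] := ltngtP n m.
    by case: (mmin n); rewrite ?n0.
  by case: (nmin m); rewrite ?m0.
pose P (i : 'I_d) := xget 0%N [set n | minper (v ord0 i) n].
apply: (@sub_finite_set _ _ (`I_M.+1 `|` P @` setT)); last first.
  by rewrite finite_setU; split; [exact: finite_II|exact: finite_image].
move=> n [n0 [x [xI xn xmin]]].
have [nM|Mn] := leqP n M; [by left|right].
have [k [i xk]] : exists k i, g (iter k g x) = v ord0 i.
  apply: contrapT => nhit; apply: nolong; exists n, x.
  have U k : uncut a b s S v (iter k g x).
    case: (stunted_cases a b s S v (iter k g x)) => // -[i E].
    by case: nhit; exists k, i.
  have E k : iter k g x = iter k S x.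
    by elim: k => //= k <-; rewrite /g stunted_uncut //; exact: U.
  split=> //; last 2 first.
  - by rewrite -E.
  - by move=> j; rewrite -E; exact: xmin.
  move=> k; split; last by rewrite -E.
  elim: k => [|k IH] /=; last exact: (sawtooth_itv hS IH).
  by move: xI; rewrite /= in_itv.
have itern m : iter (m * n) g x = x.
  by elim: m => // m IH; rewrite mulSn iterD IH.
have mv : minper (v ord0 i) n.
  split=> //.
    by rewrite -xk -iterS -iterD addnC iterD xn.
  move=> j jn; rewrite -xk -iterS => E; apply: (xmin j jn).
  (* Complete [k.+1] steps to a multiple of [n], to come back to [x]. *)
  rewrite -{1}(itern k.+1) -iterD.
  have -> : (j + k.+1 * n = (k.+1 * n - k.+1) + (j + k.+1))%N by nia.
  by rewrite iterD [in X in iter _ _ X]iterD E -iterD subnK ?itern // leq_pmulr.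
by exists i => //; exact: (minper_uniq _ _ _ (xgetPex 0%N (ex_intro _ n mv)) mv).
Qed.

(** * Moving the critical values *)

(** A maximum at height $a$ would leave no room to move inwards.  It has no
    neighbouring minimum, since that would be lower; so $d = 1$ and the stunted
    map is constant, which excludes the period $2$. *)
Lemma critical_value_inner {R : realType} {a b : R} {d : nat}
    {s : 'I_d.+1 -> bool} {S : R -> R} {w : 'rV[R]_d} (hab : a < b)
    (hs : is_shape s) (hS : sawtooth a b s S)
    (hw : critical_value_vector a b s w)
    (h2 : periods `[a, b] (stunted a b s S w) 2%N) (i : 'I_d) :
  w ord0 i != if s (widen_ord (leqnSn d) i) then a else b.
Proof.
have wI k : a <= w ord0 k <= b by case: hw => /(_ k); rewrite in_itv.
apply/eqP => wi; have [_ hlt] := hw.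
case: (posnP i) => [i0|ipos]; last first.
  have pd : (i.-1 < d)%N by apply: leq_ltn_trans (ltn_ord i); exact: leq_pred.
  have := hlt (Ordinal pd) i; rewrite /= prednK // wi => /(_ erefl).
  have /andP[wa wb] := wI (Ordinal pd).
  by rewrite /sgnb; case: (s _) => ?; lra.
have [d2|d1] := ltnP 1%N d.
  have := hlt i (Ordinal d2); rewrite /= i0 wi => /(_ erefl).
  have -> : s (widen_ord (leqnSn d) (Ordinal d2)) = ~~ s (widen_ord (leqnSn d) i).
    by apply: hs; rewrite /= i0.
  have /andP[wa wb] := wI (Ordinal d2).
  by rewrite /sgnb; case: (s _) => /= ?; lra.
have dE : d = 1%N by apply/eqP; rewrite eqn_leq d1 (leq_trans _ (ltn_ord i)).
have const y : a <= y <= b -> stunted a b s S w y = w ord0 i.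
  move=> yI; have [uy|[k ->]] := stunted_cases a b s S w y; last first.
    by congr (w ord0 _); apply: val_inj => /=; have := ltn_ord k; rewrite i0; lia.
  rewrite stunted_uncut //; have := uy i; rewrite /Defs.cut i0 lap_pt0.
  have -> : (2 = d.+1)%N by rewrite dE.
  rewrite lap_ptS yI wi; have /andP[Sa Sb] := sawtooth_itv hS yI.
  case: (s _) => [/min_idPl|/max_idPl] ?; apply/eqP; rewrite eq_le.
    by rewrite Sa andbT.
  by rewrite Sb.
have [_ [x [xI /= x2 xmin]]] := h2.
have {}xI : a <= x <= b by move: xI; rewrite /= in_itv.
apply: (xmin 1%N isT) => /=.
by rewrite -[RHS]x2 !const.
Qed.

(** A convex combination stays in $[a, b]$ without clipping, and its distance to
    [E] shrinks by a definite factor. *)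
Definition pull {R : realType} {d : nat} (t : R) (w : 'rV[R]_d) (E : 'I_d -> R) :
  'rV[R]_d := \row_i ((1 - t) * w ord0 i + t * E i).

(** The inequalities between consecutive critical values are strict and finite in
    number, so they survive a small move; how small depends on [w] only, so the
    same [t] serves for an inward and for an outward move. *)
Lemma pull_critical {R : realType} {a b : R} {d : nat} {s : 'I_d.+1 -> bool}
    {w : 'rV[R]_d} (hab : a < b) (hw : critical_value_vector a b s w)
    {eps : R} (heps : 0 < eps) :
  exists2 t, 0 < t & forall E : 'I_d -> R, (forall i, a <= E i <= b) ->
    critical_value_vector a b s (pull t w E) /\ `|pull t w E - w| < eps.
Proof.
have [wI hlt] := hw.
pose gap (jk : 'I_d * 'I_d) :=
  if jk.2 == jk.1.+1 :> nat then
    - ((w ord0 jk.1 - w ord0 jk.2) * sgnb R (s (widen_ord (leqnSn d) jk.2)))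
  else 1.
have [jk|g g0 gP] := finite_gt0_lower_bound gap.
  by rewrite /gap; case: eqP => // E; rewrite oppr_gt0; exact: hlt.
have ab0 : 0 < b - a by rewrite subr_gt0.
pose m := Num.min eps (Num.min (b - a) g).
have m0 : 0 < m by rewrite !lt_min heps ab0 g0.
have [me mb mg] : [/\ m <= eps, m <= b - a & m <= g].
  by split; rewrite !ge_min lexx ?orbT.
(* The factor 4 keeps the gaps positive: each is multiplied by at least 3/4 and
   then loses at most m/4. *)
pose t := m / (4 * (b - a)).
have t0 : 0 < t by rewrite divr_gt0 // mulr_gt0.
have tE : t * (b - a) = m / 4.
  by rewrite /t; field; rewrite gt_eqF.
have t1 : t <= 1 / 4.
  rewrite -(ler_pM2r ab0) tE; lra.
exists t => // E hE; split; [split|].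
- move=> i; rewrite !in_itv mxE /=; have /andP[E1 E2] := hE i.
  have := wI i; rewrite in_itv /= => /andP[w1 w2].
  by apply/andP; split; nra.
- move=> j k kj; rewrite !mxE.
  have := gP (j, k); rewrite /gap /= kj eqxx => gjk.
  have /andP[j1 j2] := hE j; have /andP[k1 k2] := hE k.
  have : t * (E j - E k) <= m / 4 by rewrite -tE ler_pM2l //; lra.
  have : t * (E k - E j) <= m / 4 by rewrite -tE ler_pM2l //; lra.
  move: gjk; rewrite /sgnb; case: (s _); nra.
- rewrite /Num.norm /= mx_normrE; apply: bigmax_lt => // -[i0 i] _ /=.
  rewrite !mxE (ord1 i0).
  have -> : (1 - t) * w ord0 i + t * E i - w ord0 i = t * (E i - w ord0 i) by ring.
  have := wI i; rewrite in_itv /= => /andP[w1 w2]; have /andP[E1 E2] := hE i.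
  rewrite normrM gtr0_norm //; apply: (@le_lt_trans _ _ (m / 4)); last by lra.
  by rewrite -tE ler_pM2l // ler_norml; apply/andP; split; lra.
Qed.

Theorem theorem1 (R : realType) (d : nat) (hd : (1 <= d)%N)
    (a b : R) (hab : a < b)
    (s : 'I_d.+1 -> bool) (hs : is_shape s)
    (S : R -> R) (hS : sawtooth a b s S)
    (w : 'rV[R]_d) (hw : critical_value_vector a b s w)
    (hP : periods `[a, b] (stunted a b s S w)
            = [set (2 ^ i)%N | i in [set: nat]])
    (eps : R) (heps : 0 < eps) :
  exists w' w'' : 'rV[R]_d,
    [/\ critical_value_vector a b s w',
        critical_value_vector a b s w'',
        `|w' - w| < eps,
        `|w'' - w| < eps &
        (0 < topological_entropy `[a, b] (stunted a b s S w'))%E /\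
        finite_set (periods `[a, b] (stunted a b s S w''))].
Proof.
have [t t0 tP] := pull_critical hab hw heps.
have itvE (v : 'rV[R]_d) : critical_value_vector a b s v ->
    forall i, a <= v ord0 i <= b.
  by move=> [vI _] i; have := vI i; rewrite in_itv.
have ends (c : bool) : a <= (if c then a else b) <= b.
  by case: c; rewrite lexx ltW.
pose up (i : 'I_d) := if ~~ s (widen_ord (leqnSn d) i) then a else b.
pose down (i : 'I_d) := if s (widen_ord (leqnSn d) i) then a else b.
have [w'C w'w] := tP up (fun i => ends _).
have [w''C w''w] := tP down (fun i => ends _).
exists (pull t w up), (pull t w down); split=> //; split.
  have out : outward a b s w (pull t w up).
    move=> i; have /andP[w1 w2] := itvE _ hw i; rewrite mxE /up.
    case: (s _) => /=.
      have [->|nb] := eqVneq (w ord0 i) b; [left; ring|right].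
      by have : w ord0 i < b by [rewrite lt_neqAle nb]; nra.
    have [->|na] := eqVneq (w ord0 i) a; [left; ring|right].
    by have : a < w ord0 i by [rewrite lt_neqAle eq_sym na]; nra.
  have inf : infinite_set (periods `[a, b] (stunted a b s S w)).
    rewrite hP => /(finite_image (trunc_log 2)).
    suff -> : trunc_log 2 @` [set (2 ^ i)%N | i in [set: nat]] = [set: nat].
      exact: infinite_nat.
    apply/seteqP; split=> // i _.
    by exists (2 ^ i)%N; rewrite ?trunc_expnK //; exists i.
  have [N [N0 _ [l [r [e [c [u [sub hh]]]]]]]] :=
    long_orbits_horseshoe hd hab hs hS (itvE _ w'C) out
      (infinite_periods_long_orbits hS inf).
  exact: horseshoe_entropy N0 hh sub.
have two : periods `[a, b] (stunted a b s S w) 2%N by rewrite hP; exists 1%N.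
have out : outward a b s (pull t w down) w.
  move=> i; have /andP[w1 w2] := itvE _ hw i; rewrite mxE /down.
  have := critical_value_inner hab hs hS hw two i.
  case: (s _) => ne; right.
    by have : a < w ord0 i by [rewrite lt_neqAle eq_sym ne]; nra.
  by have : w ord0 i < b by [rewrite lt_neqAle ne]; nra.
apply: contrapT => inf.
have [N [_ + [l [r [e [c [u [sub hh]]]]]]]] :=
  long_orbits_horseshoe hd hab hs hS (itvE _ hw) out
    (infinite_periods_long_orbits hS inf).
rewrite hP => -[m _ NE]; rewrite -NE in hh.
have [n + nE] := horseshoe_period hh sub.
by rewrite hP => -[i _ /esym /nE].
Qed.
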